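(* Let $L$ be a frame, let $(P;e)$ be a fuzzy dcpo and let $H_P$ be the set of all monotone maps $(P;e)\to(P;e)$. Then $(H_P;\overline e)$ is a fuzzy dcpo, where $\overline e(f,g)=\bigwedge_{x\in P}e(f(x),g(x))$ for all $f,g\in H_P$.
   Context: A frame is a complete lattice $L$ (with bottom $0$, top $1$) satisfying $a\wedge\bigvee S=\bigvee_{s\in S}(a\wedge s)$ for all $a\in L$, $S\subseteq L$; its relative pseudocomplement is $a\to b=\bigvee\{x\in L\mid a\wedge x\le b\}$. $L^X$ is the set of all maps $X\to L$. An $L$-ordered set is a pair $(X;e)$ with $X$ a set and $e:X\times X\to L$ a map such that for all $x,y,z\in X$: (E1) $e(x,x)=1$; (E2) $e(x,y)\wedge e(y,z)\le e(x,z)$; (E3) $e(x,y)=e(y,x)=1$ implies $x=y$. For $S\in L^X$, an element $x_0\in X$ is the join of $S$, written $x_0=\sqcup S$, if for all $x\in X$: $S(x)\le e(x,x_0)$ and $\bigwedge_{y\in X}(S(y)\to e(y,x))\le e(x_0,x)$. Joins are unique when they exist. $D\in L^X$ is a fuzzy directed subset of $(X;e)$ if (FD1) $\bigvee_{x\in X}D(x)=1$ and (FD2) for all $x,y\in X$, $D(x)\wedge D(y)\le\bigvee_{z\in X}(D(z)\wedge e(x,z)\wedge e(y,z))$. An $L$-ordered set is a fuzzy dcpo if every fuzzy directed subset of it has a join. A map $f:(P;e)\to(P;e)$ is monotone if $e(x,y)\le e(f(x),f(y))$ for all $x,y\in P$. *)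

(* Defs.v *)
From HB Require Import structures.
From mathcomp Require Import all_boot all_order.
From mathcomp Require Import boolp classical_sets.

Set Implicit Arguments.
Unset Strict Implicit.
Unset Printing Implicit Defensive.

Import Order.TTheory.

Local Open Scope classical_set_scope.
Local Open Scope order_scope.

(* [supremum x0 A] is [x0] when [A] is empty, so in a complete lattice the join
   of an arbitrary [A] is [supremum \bot A]; dually for [infimum \top A].
   Only joins are required below: see [infimums_neq0] for the meets. *)
HB.mixin Record TBLattice_isFrame (d : Order.disp_t) (L : Type)
    of Order.TBLattice d L := {
  supremums_neq0 : forall A : set L, (supremums A !=set0) ;
  meet_supremum : forall (a : L) (A : set L),
    a `&` supremum \bot A = supremum \bot [set a `&` s | s in A] }.

#[short(type="frameType")]
HB.structure Definition Frame (d : Order.disp_t) :=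
  { L of TBLattice_isFrame d L & Order.TBLattice d L }.

Section FrameOperations.
Context {d : Order.disp_t} {L : frameType d}.

Definition fsup {I : Type} (F : I -> L) : L := supremum \bot (range F).

Definition finf {I : Type} (F : I -> L) : L := infimum \top (range F).

Definition fimpl (a b : L) : L := supremum \bot [set x : L | a `&` x <= b].

Lemma supremum_frameP (A : set L) : supremums A (supremum \bot A).
Proof.
rewrite /supremum; case: ifPn => [/eqP ->|_].
  by split=> [x []|x _]; exact: le0x.
by case: xgetP => [x -> //|nA]; have [x /nA] := supremums_neq0 A.
Qed.

Lemma infimums_neq0 (A : set L) : (infimums A !=set0).
Proof.
have [ub lub] := supremum_frameP (lbound A).
exists (supremum \bot (lbound A)); split=> [x Ax|x xA]; last exact: ub.
by apply: lub => y; exact.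
Qed.

Lemma infimum_frameP (A : set L) : infimums A (infimum \top A).
Proof.
rewrite /infimum; case: ifPn => [/eqP ->|_].
  by split=> [x []|x _]; exact: lex1.
by case: xgetP => [x -> //|nA]; have [x /nA] := infimums_neq0 A.
Qed.

End FrameOperations.

Section FuzzyOrder.
Context {d : Order.disp_t} {L : frameType d} {X : Type}.
Implicit Types (e : X -> X -> L) (S D : X -> L).

Definition L_ordered e : Prop :=
  [/\ forall x, e x x = \top,
      forall x y z, e x y `&` e y z <= e x z
    & forall x y, e x y = \top -> e y x = \top -> x = y].

Definition is_join e S (x0 : X) : Prop :=
  forall x, S x <= e x x0 /\ finf (fun y => fimpl (S y) (e y x)) <= e x0 x.

Definition fuzzy_directed e D : Prop :=
  fsup D = \top /\
  forall x y, D x `&` D y <= fsup (fun z => D z `&` e x z `&` e y z).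

Definition fuzzy_dcpo e : Prop :=
  L_ordered e /\ forall D, fuzzy_directed e D -> exists x0, is_join e D x0.

Definition L_monotone e (f : X -> X) : Prop :=
  forall x y, e x y <= e (f x) (f y).

Definition monotone_map e : Type := {f : X -> X | L_monotone e f}.

Definition pointwise_order e (f g : monotone_map e) : L :=
  finf (fun x => e (sval f x) (sval g x)).

End FuzzyOrder.

(* Main.v *)
(** The join of a fuzzy directed family [D] of monotone maps is computed
    pointwise.  For each [x], the lower set generated by the values at [x],
    [p |-> \/_f (D f /\ e p (f x))], is fuzzy directed, and its join [j x]
    satisfies [c <= e (j x) y] iff [c /\ D f <= e (f x) y] for all [f].  This
    universal property gives the monotonicity of [j] and makes [j] the join
    of [D]. *)
Require Import Defs.
From mathcomp Require Import all_boot all_order.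
From mathcomp Require Import boolp classical_sets.

Set Implicit Arguments.
Unset Strict Implicit.
Unset Printing Implicit Defensive.

Import Order.TTheory.

Local Open Scope order_scope.

Section FrameTheory.
Context {d : Order.disp_t} {L : frameType d}.
Implicit Types a b c : L.

Lemma fsup_ub {I : Type} (F : I -> L) i : F i <= fsup F.
Proof. by have [ub _] := supremum_frameP (range F); apply: ub; exists i. Qed.

Lemma fsup_le {I : Type} (F : I -> L) b : (forall i, F i <= b) -> fsup F <= b.
Proof.
by move=> Fb; have [_ lub] := supremum_frameP (range F); apply: lub => _ [i _ <-].
Qed.

(** The frame law as an elimination rule: an existential hidden in [fsup] can be opened under a
    meet. *)
Lemma meet_fsup_le {I : Type} (F : I -> L) a b :
  (forall i, a `&` F i <= b) -> a `&` fsup F <= b.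
Proof.
move=> Fb; rewrite /fsup meet_supremum.
have [_ lub] := supremum_frameP [set (a `&` s)%O | s in range F]%classic.
by apply: lub => _ [_ [i _ <-] <-].
Qed.

Lemma finf_lb {I : Type} (F : I -> L) i : finf F <= F i.
Proof. by have [lb _] := infimum_frameP (range F); apply: lb; exists i. Qed.

Lemma le_finf {I : Type} (F : I -> L) b : (forall i, b <= F i) -> b <= finf F.
Proof.
by move=> bF; have [_ glb] := infimum_frameP (range F); apply: glb => _ [i _ <-].
Qed.

Lemma le_fimpl a b c : (c <= fimpl a b) = (a `&` c <= b).
Proof.
rewrite /fimpl; set A := [set x | (a `&` x <= b)%O]%classic.
have [ub _] := supremum_frameP A.
apply/idP/idP => [cA|]; last exact: ub.
(* By distributivity, [fimpl a b] is itself a solution of the inequality it is the join of. *)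
apply: (le_trans (leI2 (lexx a) cA)); rewrite meet_supremum.
have [_ lub] := supremum_frameP [set (a `&` s)%O | s in A]%classic.
by apply: lub => _ [s As <-].
Qed.

End FrameTheory.

Section FuzzyOrderTheory.
Context {d : Order.disp_t} {L : frameType d} {X : Type}.
Variable e : X -> X -> L.

Lemma is_join_ub S x0 : is_join e S x0 -> forall x, S x <= e x x0.
Proof. by move=> jS x; have [] := jS x. Qed.

(** Residuation turns each hypothesis into [c <= fimpl (S x) (e x y)], so [c] lies below their
    meet. *)
Lemma is_join_lub S x0 : is_join e S x0 ->
  forall c y, (forall x, c `&` S x <= e x y) -> c <= e x0 y.
Proof.
move=> jS c y cS; have [_] := jS y; apply: le_trans.
by apply: le_finf => x; rewrite le_fimpl meetC.
Qed.

Lemma pointwise_order_le (f g : monotone_map e) x :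
  pointwise_order f g <= e (sval f x) (sval g x).
Proof. exact: (finf_lb (fun x => e (sval f x) (sval g x))). Qed.

Lemma pointwise_order_L_ordered :
  L_ordered e -> L_ordered (@pointwise_order d L X e).
Proof.
case=> e1 e2 e3; split=> [f|f g h|f g fg gf].
- by apply/eqP; rewrite -le1x; apply: le_finf => x; rewrite e1.
- apply: le_finf => x; apply: le_trans (e2 _ (sval g x) _).
  by rewrite leI2 ?pointwise_order_le.
- apply: eq_sig_hprop => [h|]; first exact: Prop_irrelevance.
  apply/funext => x; apply: e3; apply/eqP; rewrite -le1x.
    by rewrite -fg pointwise_order_le.
  by rewrite -gf pointwise_order_le.
Qed.

Definition values_at (D : monotone_map e -> L) (x p : X) : L :=
  fsup (fun f => D f `&` e p (sval f x)).

Lemma fuzzy_directed_values_at D x : L_ordered e ->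
  fuzzy_directed (@pointwise_order d L X e) D ->
  fuzzy_directed e (values_at D x).
Proof.
case=> e1 e2 _ [D1 D2]; split.
  (* The point [sval f x] belongs to the lower set to degree at least [D f], by reflexivity. *)
  apply/eqP; rewrite -le1x -D1; apply: fsup_le => f.
  apply: le_trans (fsup_ub _ (sval f x)).
  by apply: le_trans (fsup_ub _ f); rewrite e1 meetx1.
move=> p q; apply: meet_fsup_le => g; rewrite meetC; apply: meet_fsup_le => f.
(* Isolating [D f] and [D g] lets directedness of [D] supply an [h] above [f] and [g]; its value at
   [x] then serves as upper bound of [p] and [q]. *)
rewrite meetACA meetC (meetC (D g)).
apply: (le_trans (leI2 (lexx _) (D2 f g))); apply: meet_fsup_le => h.
apply: le_trans (fsup_ub _ (sval h x)).
rewrite !lexI -andbA; apply/and3P; split.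
- apply: leIxr; do 2 apply: leIxl.
  by apply: le_trans (fsup_ub _ h); rewrite e1 meetx1.
- apply: le_trans (e2 _ (sval f x) _); apply: leI2; first exact: leIr.
  by apply: leIxl; apply: leIxr; exact: pointwise_order_le.
- apply: le_trans (e2 _ (sval g x) _); apply: leI2; first exact: leIl.
  by apply: leIxr; exact: pointwise_order_le.
Qed.

Section PointwiseJoin.
Variables (D : monotone_map e -> L) (j : X -> X).
Hypothesis e_ord : L_ordered e.
Hypothesis jP : forall x, is_join e (values_at D x) (j x).

Lemma pointwise_join_ub f x : D f <= e (sval f x) (j x).
Proof.
have [e1 _ _] := e_ord; apply: le_trans (is_join_ub (jP x) _).
by apply: le_trans (fsup_ub _ f); rewrite e1 meetx1.
Qed.

(** By transitivity through [sval f x], a bound on the values at [x] also bounds the lower set they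
    generate. *)
Lemma pointwise_join_lub c x y :
  (forall f, c `&` D f <= e (sval f x) y) -> c <= e (j x) y.
Proof.
have [_ e2 _] := e_ord => cD; apply: (is_join_lub (jP x)) => p.
apply: meet_fsup_le => f; apply: le_trans (e2 _ (sval f x) _).
by rewrite meetA meetC leI2.
Qed.

Lemma pointwise_join_monotone : L_monotone e j.
Proof.
have [_ e2 _] := e_ord => x x'; apply: pointwise_join_lub => f.
(* Here [c] is [e x x']: monotonicity of [f] leads to [sval f x'], which [D f] places below
   [j x']. *)
apply: le_trans (e2 _ (sval f x') _).
by rewrite leI2 ?pointwise_join_ub // (svalP f).
Qed.

Lemma pointwise_join_is_join :
  is_join (@pointwise_order d L X e) D (exist _ j pointwise_join_monotone).
Proof.
move=> g; split; first by apply: le_finf => x; exact: pointwise_join_ub.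
(* Here [c] is the degree to which [g] bounds [D]; meeting it with [D f] undoes the implication at
   [f]. *)
apply: le_finf => x; apply: pointwise_join_lub => f /=.
apply: le_trans (pointwise_order_le f g x).
by rewrite meetC -le_fimpl (finf_lb (fun h => fimpl (D h) (pointwise_order h g))).
Qed.

End PointwiseJoin.

End FuzzyOrderTheory.

Theorem theorem4p1 (d : Order.disp_t) (L : frameType d) (P : Type)
  (e : P -> P -> L) (hP : fuzzy_dcpo e) :
  fuzzy_dcpo (@pointwise_order d L P e).
Proof.
have [e_ord e_joins] := hP; split=> [|D D_dir].
  exact: pointwise_order_L_ordered.
(* Joins exist at each [x] separately; choice gathers them into one map. *)
have /choice[j jP] x : exists x0, is_join e (values_at D x) x0.
  exact/e_joins/fuzzy_directed_values_at.
by eexists; exact: pointwise_join_is_join e_ord jP.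
Qed.
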